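(* Let $n,p\ge 1$ be integers, let $\mu$ be a probability mass function on $\{0,1,\dots,n\}$, and define $$\widetilde Q_{\mu,p}:=\sum_{u=0}^{n}\mu(n-u)\,\widetilde Q_{n-u,p},\qquad S_\mu(\ell):=\sum_{u=0}^{\ell}\mu(n-u)\,u!\,p^u\quad(0\le \ell\le n).$$ Then $$\frac{\widetilde Q_{\mu,p}(x)}{U(x)}=S_\mu(L_p(x))\qquad(x\in G_{n,p}),$$ and, for every $\Phi:[0,\infty)\to\mathbb R$ for which the sums are finite, $$\sum_{x\in G_{n,p}}U(x)\,\Phi\!\left(\frac{\widetilde Q_{\mu,p}(x)}{U(x)}\right)=\sum_{\ell=0}^{n}U\{L_p=\ell\}\,\Phi\bigl(S_\mu(\ell)\bigr).$$ Moreover, $$\mathrm{sep}(\widetilde Q_{\mu,p},U)=\begin{cases}1-\mu(n)-\mu(n-1), & p=1,\\ 1-\mu(n), & p\ge2,\end{cases}$$ and $$\left\|\frac{\widetilde Q_{\mu,p}(\cdot)}{U(\cdot)}-1\right\|_{L^\infty(U)}=S_\mu(n)-1=\sum_{u=0}^{n}\mu(n-u)\,u!\,p^u-1.$$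
   Context: For integers $n,p\ge1$, $C_p=\mathbb Z/p\mathbb Z$ (written additively) and $G_{n,p}=C_p\wr S_n$ is the group of $p$-colored permutations, realized as the set $C_p^{\,n}\times S_n$ with multiplication $(t,\tau)(s,\sigma)=(\sigma t+s,\tau\sigma)$, where $\sigma t:=(t_{\sigma(1)},\dots,t_{\sigma(n)})$. An element $(s,\sigma)$ is viewed as an arrangement in which position $i$ carries the label $\sigma(i)$ with color $s_i$. $U$ is the uniform law on $G_{n,p}$, $U(x)=1/(p^n n!)$. For $0\le u\le n$, $A_u\subseteq G_{n,p}$ is the set of $(s,\sigma)$ such that the largest $u$ labels appear in increasing order and have color $0$: $\sigma^{-1}(n-u+1)<\cdots<\sigma^{-1}(n)$ and $s_{\sigma^{-1}(j)}=0$ for $n-u+1\le j\le n$; in particular $A_0=G_{n,p}$. For $0\le u\le n$, $\widetilde Q_{n-u,p}$ is the uniform probability measure on $A_u$. $L_p(x):=\max\{u\in\{0,\dots,n\}:x\in A_u\}$. For a probability measure $M$ on $G_{n,p}$, $\mathrm{sep}(M,U):=1-\min_x M(x)/U(x)$, and $\|f\|_{L^\infty(U)}:=\max_x|f(x)|$. *)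

(* Defs.v *)
From HB Require Import structures.
From mathcomp Require Import all_boot all_order all_algebra all_fingroup reals.

Set Implicit Arguments.
Unset Strict Implicit.
Unset Printing Implicit Defensive.

Import Order.TTheory GRing.Theory Num.Theory.
Local Open Scope ring_scope.

(* The modulus is p.-1.+1 (equal to p when 0 < p) so that 'I_p.-1.+1 carries
   the canonical additive group of integers mod p for p = 1 as well: 'Z_1
   would be Z/2Z. *)
Definition color (p : nat) : Type := 'I_p.-1.+1.

HB.instance Definition _ (p : nat) := Finite.on (color p).
HB.instance Definition _ (p : nat) := GRing.Zmodule.on (color p).

(* (s, sigma) puts at position i the label sigma i with color s i; positions
   and labels are numbered from 0. *)
Definition colored_perm (n p : nat) : Type :=
  ({ffun 'I_n -> color p} * 'S_n)%type.

HB.instance Definition _ (n p : nat) := Finite.on (colored_perm n p).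

Section WreathProduct.
Variables n p : nat.
Implicit Types x y z : colored_perm n p.

(* (t, tau)(s, sigma) = (sigma t + s, tau o sigma), where
   (sigma t)_i = t_(sigma i).  In 'S_n, (sigma * tau)%g i = tau (sigma i), so
   tau o sigma is (sigma * tau)%g. *)
Definition cp_mul x y : colored_perm n p :=
  ([ffun i => x.1 (y.2 i) + y.1 i], (y.2 * x.2)%g).

Definition cp_one : colored_perm n p := ([ffun=> 0], 1%g).

Definition cp_inv x : colored_perm n p :=
  ([ffun i => - x.1 ((x.2^-1)%g i)], (x.2^-1)%g).

Lemma cp_mulA : associative cp_mul.
Proof.
move=> x y z; congr pair; last by rewrite /= mulgA.
by apply/ffunP => i; rewrite !ffunE /= permM addrA.
Qed.

Lemma cp_mul1 : left_id cp_one cp_mul.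
Proof.
move=> [s sigma]; congr pair; last by rewrite /= mulg1.
by apply/ffunP => i; rewrite !ffunE add0r.
Qed.

Lemma cp_mulV : left_inverse cp_one cp_inv cp_mul.
Proof.
move=> x; congr pair; last by rewrite /= mulgV.
by apply/ffunP => i; rewrite !ffunE /= permK addNr.
Qed.

HB.instance Definition _ :=
  Finite_isGroup.Build (colored_perm n p) cp_mulA cp_mul1 cp_mulV.

End WreathProduct.

(* With 0-based labels the largest u labels are the j with n - u <= j. *)
Definition A_top (n p u : nat) : {set colored_perm n p} :=
  [set x : colored_perm n p |
     [forall j : 'I_n, forall k : 'I_n,
        (n - u <= j)%N ==> (j < k)%N ==>
          ((x.2^-1)%g j < (x.2^-1)%g k)%N]
  && [forall j : 'I_n, (n - u <= j)%N ==> (x.1 ((x.2^-1)%g j) == 0)]].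

Definition L_top (n p : nat) (x : colored_perm n p) : nat :=
  \max_(u < n.+1 | x \in A_top n p u) u.

Definition unif (R : realType) (T : finType) (A : {set T}) (x : T) : R :=
  (x \in A)%:R / #|A|%:R.

Definition U (R : realType) (n p : nat) : colored_perm n p -> R :=
  unif R [set: colored_perm n p].

Definition Qt (R : realType) (n p k : nat) : colored_perm n p -> R :=
  unif R (A_top n p (n - k)).

Definition is_pmf (R : realType) (T : finType) (mu : T -> R) : Prop :=
  (forall k, 0 <= mu k) /\ \sum_k mu k = 1.

(* sub_ord u is n - u as an element of 'I_n.+1. *)
Definition Qt_mix (R : realType) (n p : nat) (mu : 'I_n.+1 -> R)
    (x : colored_perm n p) : R :=
  \sum_(0 <= u < n.+1) mu (sub_ord u) * Qt R (n - u) x.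

Definition S_mix (R : realType) (n p : nat) (mu : 'I_n.+1 -> R) (l : nat) : R :=
  \sum_(0 <= u < l.+1) mu (sub_ord u) * u`!%:R * p%:R ^+ u.

Definition Pr (R : realType) (T : finType) (M : T -> R) (E : {set T}) : R :=
  \sum_(x in E) M x.

(* The initial value f 1 is a value of f, so this is the minimum of f. *)
Definition min_val (R : realType) (G : finGroupType) (f : G -> R) : R :=
  \big[Num.min/f 1%g]_(x : G) f x.

Definition sep (R : realType) (n p : nat) (M N : colored_perm n p -> R) : R :=
  1 - min_val (fun x => M x / N x).

(* As U gives positive mass to every point, the norm of L^oo(U) is a maximum
   over the whole group. *)
Definition Linf_norm (R : realType) (n p : nat) (f : colored_perm n p -> R) : R :=
  \big[Num.max/0]_(x : colored_perm n p) `|f x|.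

(* Main.v *)
(* Left multiplication by the subgroup of colored permutations supported on the
   largest u labels relabels and recolors only those labels, and every orbit
   contains exactly one element in which they are sorted and have color 0.
   Hence |G| / |A_u| = u! p^u, and the density of the mixture at x is the sum of
   mu(n-u) u! p^u over the u with x in A_u, that is, over u <= L(x).  Its values
   S(l) are nondecreasing in l; the largest, S(n), is attained at the identity
   and the smallest, S([p = 1]), at the reversal with all colors 1.  The maximum
   of |S(L(x)) - 1| is S(n) - 1 because S([p = 1]) + S(n) >= 2. *)

Require Import Defs.
From mathcomp Require Import all_boot all_order all_algebra all_fingroup reals.
From mathcomp Require Import lra zify.

Set Implicit Arguments.
Unset Strict Implicit.
Unset Printing Implicit Defensive.

Import Order.TTheory GRing.Theory Num.Theory.
Local Open Scope ring_scope.

(** * Sorting the largest labels *)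

Definition top (n m : nat) : {set 'I_n} := [set j : 'I_n | (m <= j)%N].

Lemma card_ord_between (n m d : nat) :
  (d <= n)%N -> #|[set j : 'I_n | (m <= j < d)%N]| = (d - m)%N.
Proof.
move=> le_dn; rewrite -[RHS]muln1 -sum_nat_const_nat.
rewrite (big_nat_widen _ _ n) // big_geq_mkord /= -sum1_card.
by apply: eq_bigl => j; rewrite inE andbC.
Qed.

Lemma card_top (n u : nat) : (u <= n)%N -> #|top n (n - u)| = u.
Proof.
move=> le_un; rewrite -[RHS](subKn le_un) -(card_ord_between (n - u) (leqnn n)).
by apply: eq_card => j; rewrite !inE ltn_ord andbT.
Qed.

Section SortingPermutation.
Variables (n m : nat) (f : 'S_n).

Let D := top n m.

(** Here [f] stands for the map from labels to positions. The offset [m] makes the ranks fill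
    [[m, n)], so that sorting permutes [D]. *)
Let rank (a : 'I_n) : nat := (m + #|[set b in D | (f b < f a)%N]|)%N.

Lemma rank_lt a : a \in D -> (rank a < n)%N.
Proof.
move=> aD; have [le_ma lt_an] : (m <= a /\ a < n)%N by rewrite inE in aD.
suff: (#|[set b in D | (f b < f a)%N]| < #|D|)%N.
  have -> : #|D| = (n - m)%N.
    by rewrite -(@card_top n (n - m)) ?leq_subr // subKn //; lia.
  by rewrite /rank; lia.
apply: proper_card; apply/properP; split.
  by apply/subsetP => b; rewrite inE => /andP[].
by exists a => //; rewrite inE ltnn andbF.
Qed.

Lemma rank_mono a b : b \in D -> (f b < f a)%N -> (rank b < rank a)%N.
Proof.
move=> bD lt_ba; rewrite /rank ltn_add2l; apply: proper_card.
apply/properP; split.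
  apply/subsetP => c; rewrite !inE => /andP[-> lt_cb] /=.
  exact: ltn_trans lt_ba.
by exists b; rewrite inE ?bD ?lt_ba ?ltnn.
Qed.

(** The default [a] is taken only when the rank is out of range, which cannot happen on [D]. *)
Let rank_ord (a : 'I_n) : 'I_n := insubd a (rank a).

Lemma rank_ordE a : a \in D -> rank_ord a = rank a :> nat.
Proof. by move=> aD; rewrite insubdK // unfold_in rank_lt. Qed.

Lemma rank_ord_inj : {in D &, injective rank_ord}.
Proof.
move=> a b aD bD /(congr1 val) /=; rewrite !rank_ordE // => eq_ab.
apply: (@perm_inj _ f); apply: val_inj => /=.
have [lt_ab|lt_ba|//] := ltngtP (f a) (f b).
  by have := rank_mono aD lt_ab; rewrite eq_ab ltnn.
by have := rank_mono bD lt_ba; rewrite eq_ab ltnn.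
Qed.

Lemma rank_ord_top : [set rank_ord x | x in D] \subset D.
Proof.
apply/subsetP => _ /imsetP[a aD ->].
by rewrite inE rank_ordE // leq_addr.
Qed.

(* The sorting permutation must send each label to its rank among the labels
   in [m, n), ordered by their positions. *)
Lemma sort_perm_uniq : exists rho : 'S_n, forall tau : 'S_n,
  perm_on (top n m) tau &&
    [forall j : 'I_n, forall k : 'I_n, (m <= j)%N ==> (j < k)%N ==>
       (f ((tau^-1)%g j) < f ((tau^-1)%g k))%N] = (tau == rho).
Proof.
pose rho := perm_in rank_ord_inj rank_ord_top.
have rho_on : perm_on D rho := perm_in_on _ _.
have rhoE a : a \in D -> rho a = rank a :> nat.
  by move=> aD; rewrite perm_inE // rank_ordE.
exists rho => tau; apply/andP/eqP => [[tau_on /forallP tau_inc] | ->].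
  have tau_lt a b : a \in D -> (tau a < tau b)%N -> (f a < f b)%N.
    move=> aD lt_ab; have /forallP/(_ (tau b)) := tau_inc (tau a).
    by rewrite !permK lt_ab -[(m <= _)%N](in_set (fun j : 'I_n => m <= j)%N)
      (perm_closed _ tau_on) aD.
  have tau_ltE a b : a \in D -> b \in D -> (f b < f a)%N = (tau b < tau a)%N.
    move=> aD bD; apply/idP/idP => [lt_ba|]; last exact: tau_lt.
    rewrite ltnNge; apply/negP; rewrite leq_eqVlt => /orP[/eqP eq_ab|].
      by move: lt_ba; rewrite (perm_inj (val_inj eq_ab)) ltnn.
    by move=> /(tau_lt _ _ aD); rewrite ltnNge ltnW.
  apply/permP => a; apply: val_inj => /=.
  have [aD|aD] := boolP (a \in D); last first.
    by rewrite (out_perm tau_on aD) (out_perm rho_on aD).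
  have tauaD : (m <= tau a)%N by have := perm_closed a tau_on; rewrite aD inE.
  rewrite rhoE // /rank -[LHS](subnKC tauaD); congr addn.
  (* As [tau] permutes [D] and orders it as [f] does, the labels in [[m, tau a)] are the
     [tau]-images of the labels counted by [rank a]. Hence [tau a] is forced. *)
  rewrite -(@card_ord_between n m (tau a)); last exact/ltnW/ltn_ord.
  rewrite -(card_imset (mem [set b in D | (f b < f a)%N]) (@perm_inj _ tau)).
  apply: eq_card => c; rewrite inE; apply/idP/imsetP => [/andP[le_mc lt_ca]|].
    have cD : (tau^-1)%g c \in D by rewrite (perm_closed _ (perm_onV tau_on)) inE.
    by exists ((tau^-1)%g c); rewrite ?permKV // inE cD tau_ltE // permKV.
  move=> [b]; rewrite inE => /andP[bD lt_ba] ->.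
  rewrite -tau_ltE // lt_ba andbT.
  by have := perm_closed b tau_on; rewrite bD inE.
split=> //; apply/forallP => j; apply/forallP => k.
apply/implyP => le_mj; apply/implyP => lt_jk.
set a := (rho^-1)%g j; set b := (rho^-1)%g k.
have rhoV := perm_onV rho_on.
have aD : a \in D by rewrite (perm_closed _ rhoV) inE.
have bD : b \in D by rewrite (perm_closed _ rhoV) inE (leq_trans le_mj) // ltnW.
have lt_r : (rank a < rank b)%N by rewrite -!rhoE // !permKV.
rewrite ltnNge; apply/negP; rewrite leq_eqVlt => /orP[/eqP eq_ab|].
  by move: lt_r; rewrite (perm_inj (val_inj eq_ab)) ltnn.
by move=> /(rank_mono bD); rewrite ltnNge ltnW.
Qed.

End SortingPermutation.

(** * The orbit count giving the size of [A_top] *)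

(** In [h * x] the colors [h.1] are read at [x.2 i], so the support condition on [h.1] concerns
    labels of [x], not positions. *)
Definition top_subgroup (n p u : nat) : {set colored_perm n p} :=
  [set h : colored_perm n p |
     (h.1 \in pffun_on (0 : color p) (top n (n - u)) predT)
     && perm_on (top n (n - u)) h.2].

Lemma card_top_subgroup (n p u : nat) : (0 < p)%N -> (u <= n)%N ->
  #|top_subgroup n p u| = (u`! * p ^ u)%N.
Proof.
move=> p_gt0 le_un; rewrite cardsE.
rewrite -[LHS]/(#|[predX (pffun_on (0 : color p) (top n (n - u)) predT)
  & perm_on (top n (n - u))]|).
rewrite cardX card_pffun_on card_perm card_top // mulnC.
by congr (_ * _ ^ _)%N; rewrite card_ord prednK.
Qed.

(** The two conditions decouple: the order condition involves only the permutation part of [h] and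
    has one solution by [sort_perm_uniq]; the color condition then fixes the color part on the top
    labels, and the support condition fixes it elsewhere. *)
Lemma top_subgroup_translate (n p u : nat) (x : colored_perm n p) :
  #|[set h in top_subgroup n p u | (h * x)%g \in A_top n p u]| = 1%N.
Proof.
case: x => s sigma; have [rho rhoP] := sort_perm_uniq (n - u) (sigma^-1)%g.
(* Label [k] sits at position [sigma^-1 k]; [t] cancels its color there. *)
pose t : {ffun 'I_n -> color p} :=
  [ffun k => if k \in top n (n - u) then - s ((sigma^-1)%g k) else 0].
suff -> : [set h in top_subgroup n p u | (h * (s, sigma))%g \in A_top n p u]
    = [set (t, rho)] by rewrite cards1.
apply/setP => -[t' tau]; rewrite [RHS]in_set1 xpair_eqE -rhoP.
have -> : ((t', tau) \in [set h in top_subgroup n p u | (h * (s, sigma))%g \in A_top n p u])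
    = [&& t' \in pffun_on (0 : color p) (top n (n - u)) predT,
          perm_on (top n (n - u)) tau,
          [forall j : 'I_n, forall k : 'I_n, (n - u <= j)%N ==> (j < k)%N ==>
             ((sigma^-1)%g ((tau^-1)%g j) < (sigma^-1)%g ((tau^-1)%g k))%N]
        & [forall j : 'I_n, (n - u <= j)%N ==>
             (t' ((tau^-1)%g j) + s ((sigma^-1)%g ((tau^-1)%g j)) == 0)]].
  rewrite in_set in_set in_set /= invMg -andbA; congr [&& _, _, _ & _].
    by apply: eq_forallb => j; apply: eq_forallb => k; rewrite !permM.
  by apply: eq_forallb => j; rewrite permM ffunE permKV.
set inc := [forall j, _].
have [tau_on|] := boolP (perm_on _ tau); last by rewrite !andbF.
rewrite /= andbCA andbC; congr andb.
apply/andP/eqP => [[/pffun_onP[/supportP supp _] /forallP t0]|->].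
  apply/ffunP => k; rewrite ffunE; case: ifPn => [kD|/supp //].
  have := t0 (tau k); rewrite permK addr_eq0 => /implyP t0k; apply/eqP/t0k.
  by have := perm_closed k tau_on; rewrite kD inE.
split.
  apply/pffun_onP; split=> [|y _]; last by [].
  by apply/supportP => k kD; rewrite ffunE (negPf kD).
apply/forallP => j; apply/implyP => le_j; rewrite ffunE.
by rewrite (perm_closed _ (perm_onV tau_on)) inE le_j addNr.
Qed.

(** Double counting of the pairs [(h, x)] with [h * x] in [A]: each [x] has exactly one partner [h],
    and each [h] has [#|A|] partners [x], namely the translate of [A] by [h^-1]. *)
Lemma card_A_top (n p u : nat) : (0 < p)%N -> (u <= n)%N ->
  (#|A_top n p u| * (u`! * p ^ u))%N = #|[set: colored_perm n p]|.
Proof.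
move=> p_gt0 le_un; rewrite -(card_top_subgroup p_gt0 le_un).
set H := top_subgroup _ _ _; set A := A_top _ _ _.
have -> : #|[set: colored_perm n p]| =
    (\sum_(x : colored_perm n p) \sum_(h in H) ((h * x)%g \in A))%N.
  rewrite cardsT -sum1_card; apply: eq_bigr => x _.
  by rewrite -(top_subgroup_translate u x) -big_mkcondr sum1dep_card.
rewrite exchange_big /= mulnC -sum_nat_const; apply: eq_bigr => h _.
rewrite -big_mkcond sum1dep_card -(card_imset A (mulgI h^-1)%g).
apply: eq_card => x; rewrite inE.
apply/imsetP/idP => [[a aA ->]|hxA]; first by rewrite mulKVg.
by exists (h * x)%g; rewrite ?mulKg.
Qed.

(** * The nested sets [A_top] and the range of [L_top] *)

Section TopLabels.
Variables n p : nat.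
Implicit Types x : colored_perm n p.

Lemma A_top0 x : x \in A_top n p 0.
Proof.
have gt_j (j : 'I_n) : (n - 0 <= j)%N = false by rewrite subn0 leqNgt ltn_ord.
rewrite inE; apply/andP; split; apply/forallP => j; last by rewrite gt_j.
by apply/forallP => k; rewrite gt_j.
Qed.

Lemma A_top_one u : 1%g \in A_top n p u.
Proof.
rewrite inE invg1; apply/andP; split.
  by apply/forallP => j; apply/forallP => k; rewrite !perm1 implybb implybT.
by apply/forallP => j; rewrite ffunE eqxx implybT.
Qed.

Lemma A_top_anti u v : (u <= v)%N -> A_top n p v \subset A_top n p u.
Proof.
move=> le_uv; apply/subsetP => x; rewrite !inE => /andP[/forallP inc /forallP col].
have le_nv j : (n - u <= j)%N -> (n - v <= j)%N by apply: leq_trans; exact: leq_sub2l.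
apply/andP; split; apply/forallP => j.
  apply/forallP => k; apply/implyP => /le_nv le_j.
  by have /forallP/(_ k) := inc j; rewrite le_j.
by apply/implyP => /le_nv le_j; have := col j; rewrite le_j.
Qed.

Lemma L_top_le x : (L_top x <= n)%N.
Proof. by apply/bigmax_leqP => u _; rewrite -ltnS. Qed.

(** The sets decrease in [u], and the maximum defining [L_top] is attained because [A_top n p 0] is
    everything. *)
Lemma A_topE x u : (u <= n)%N -> (x \in A_top n p u) = (u <= L_top x)%N.
Proof.
rewrite -ltnS => lt_un; apply/idP/idP => [xA|le_uL].
  by rewrite (@leq_bigmax_cond _ _ _ (Ordinal lt_un)).
have [[v _] /= vA Lv] : {v : 'I_n.+1 | x \in A_top n p v & L_top x = v}.
  by apply: eq_bigmax_cond; apply/card_gt0P; exists ord0; exact: A_top0.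
by apply: (subsetP (A_top_anti _)) vA; rewrite -Lv.
Qed.

Lemma L_top_one : L_top (1%g : colored_perm n p) = n.
Proof. by apply/eqP; rewrite eqn_leq L_top_le -A_topE ?A_top_one. Qed.

(** For [p = 1] a single label is trivially sorted and 0 is the only color, so [A_top n p 1] is the
    whole group. *)
Lemma L_top_ge x : (0 < n)%N -> ((p == 1%N) <= L_top x)%N.
Proof.
case: eqP => //= p1 n_gt0; rewrite -A_topE // inE; apply/andP; split.
  apply/forallP => j; apply/forallP => k; apply/implyP => le_j.
  by apply/implyP => lt_jk; have := ltn_ord k; lia.
apply/forallP => j; apply/implyP => _; apply/eqP/val_inj => /=.
by case: (x.1 _) => c /=; rewrite p1; case: c.
Qed.

(* Reversed labels, all with color 1, are as far as possible from being in
   A_u. *)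
Lemma L_top_min : (0 < n)%N -> (0 < p)%N ->
  exists x, L_top x = (p == 1%N).
Proof.
move=> n_gt0 p_gt0; pose rev := perm (@rev_ord_inj n).
(* For [p = 1], [inord 1] falls back to the only color, 0. *)
pose x : colored_perm n p := ([ffun=> inord 1], rev).
exists x; apply/eqP; rewrite eqn_leq L_top_ge // andbT leqNgt; apply/negP => lt.
have le_Ln := L_top_le x.
have : x \in A_top n p (L_top x) by rewrite A_topE.
rewrite inE => /andP[/forallP inc /forallP col].
have last_lt : (n.-1 < n)%N by rewrite prednK.
have le_last : (n - L_top x <= n.-1)%N by lia.
(* The last label lies among the top [L_top x] labels, so its color 1 must vanish. *)
have p1 : p = 1%N.
  have := col (Ordinal last_lt); rewrite le_last /= ffunE => /eqP/(congr1 val).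
  case: (p =P 1%N) => // p_neq1; rewrite /= inordK //; lia.
have eq_p1 : (p == 1%N) = true by apply/eqP.
rewrite eq_p1 /= in lt.
(* With [p = 1] the assumption reads [1 < L_top x], so the last two labels would have to be in
   order, yet they are reversed. *)
have pen_lt : (n.-2 < n)%N by lia.
have /forallP/(_ (Ordinal last_lt)) := inc (Ordinal pen_lt).
have revV (j : 'I_n) : ((x.2)^-1)%g j = rev_ord j.
  by apply: (@perm_inj _ rev); rewrite permKV permE rev_ordK.
rewrite !revV /=; lia.
Qed.

End TopLabels.

(** * Density of the mixture, separation and sup norm *)

Lemma min_val_eq (R : realType) (G : finGroupType) (f : G -> R) (m : R) :
  (forall g, m <= f g) -> (exists g, f g = m) -> min_val f = m.
Proof.
move=> m_le [g fg]; apply/le_anti/andP; split.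
  by rewrite -fg; exact: bigmin_le.
by apply: le_bigmin => [|h _]; exact: m_le.
Qed.

Section Mixture.
Variables (R : realType) (n p : nat).
Hypotheses (hn : (0 < n)%N) (hp : (0 < p)%N).
Variable mu : 'I_n.+1 -> R.
Hypothesis hmu : is_pmf mu.
Implicit Type x : colored_perm n p.

(** For [u <= n] this is the index [|G| / |A_u|], the value on [A_u] of the density of its uniform
    law with respect to [U]. *)
Let w (u : nat) : R := u`!%:R * p%:R ^+ u.

Lemma w_ge0 u : 0 <= w u.
Proof. by rewrite mulr_ge0 ?exprn_ge0 ?ler0n. Qed.

Lemma mu_ge0 k : 0 <= mu k.
Proof. exact: hmu.1. Qed.

(** Indicators put all partial sums over the same index set, so that they can be compared term by
    term. *)
Lemma S_mixE l : (l <= n)%N ->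
  S_mix p mu l = \sum_(u < n.+1) mu (sub_ord u) * ((u <= l)%N%:R * w u).
Proof.
move=> le_ln; rewrite /S_mix big_mkord (big_ord_widen n.+1 (fun u =>
  mu (sub_ord u) * u`!%:R * p%:R ^+ u)) // big_mkcond; apply: eq_bigr => u _.
by rewrite ltnS; case: leqP; rewrite ?mul1r ?mul0r ?mulr0 // mulrA.
Qed.

Lemma S_mix_mono k l : (k <= l <= n)%N -> S_mix p mu k <= S_mix p mu l.
Proof.
move=> /andP[le_kl le_ln]; rewrite !S_mixE ?(leq_trans le_kl) //.
apply: ler_sum => u _; rewrite ler_wpM2l ?mu_ge0 //.
rewrite ler_wpM2r ?w_ge0 ?ler_nat //.
by case: (leqP u k) => [/leq_trans/(_ le_kl) ->|].
Qed.

Lemma sum_mu_sub_ord : \sum_(u < n.+1) mu (sub_ord u) = 1.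
Proof.
rewrite -hmu.2 [RHS](reindex (fun u : 'I_n.+1 => sub_ord u)) //.
apply: onW_bij; exists (fun u : 'I_n.+1 => sub_ord u) => u;
  by apply: val_inj; rewrite /= sub_ordK.
Qed.

(* The weight u! p^u is at least 2 except at the indices u <= [p = 1], where
   it is 1 and is counted twice. *)
Lemma S_mix_two : 2 <= S_mix p mu (p == 1%N) + S_mix p mu n.
Proof.
have le1n : ((p == 1%N) <= n)%N by case: eqP.
rewrite !S_mixE // -big_split /=.
(* Writing 2 as a [mu]-average reduces the inequality to one on the weights for each [u]. *)
have -> : 2 = \sum_(u < n.+1) mu (sub_ord u) * 2 :> R.
  by rewrite -mulr_suml sum_mu_sub_ord mul1r.
apply: ler_sum => u _; rewrite -mulrDr; rewrite ler_wpM2l ?mu_ge0 //.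
have -> : (u <= n)%N by rewrite -ltnS.
rewrite mul1r /w -natrX -natrM -natrM -natrD ler_nat.
case: u => -[|[|u]] _ /=.
- by rewrite fact0 expn0.
- by rewrite factS fact0 expn1 !mul1n; case: (p =P 1%N) => /=; lia.
have fact2 : (2 <= u.+2`!)%N.
  by rewrite factS (leq_trans (_ : 2 <= u.+2 * 1)%N) // leq_mul2l fact_gt0.
have pX : (0 < p ^ u.+2)%N by rewrite expn_gt0 hp.
by apply: leq_trans (leq_addl _ _); rewrite -[2%N]muln1 leq_mul.
Qed.

Lemma density_A_top u x : (u <= n)%N ->
  unif R (A_top n p u) x / U R x = (u <= L_top x)%N%:R * w u.
Proof.
move=> le_un; rewrite /U /unif in_setT mulr1n div1r invrK A_topE // -(card_A_top hp le_un).
rewrite !natrM natrX -/(w u); case: leqP => _; rewrite ?mul0r // mulrA.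
rewrite mulfVK // pnatr_eq0 -lt0n; apply/card_gt0P.
by exists 1%g; exact: A_top_one.
Qed.

Lemma Qt_mix_density x : Qt_mix mu x / U R x = S_mix p mu (L_top x).
Proof.
rewrite S_mixE ?L_top_le // /Qt_mix big_mkord mulr_suml; apply: eq_bigr => u _.
have le_un : (u <= n)%N by rewrite -ltnS.
by rewrite -mulrA; congr (_ * _); rewrite /Qt subKn // density_A_top.
Qed.

(** The group is partitioned by the value of [L_top], on which alone the density depends. *)
Lemma sum_U_density (Phi : R -> R) :
  \sum_(x : colored_perm n p) U R x * Phi (Qt_mix mu x / U R x)
  = \sum_(0 <= l < n.+1)
      Pr (@U R n p) [set x | L_top x == l] * Phi (S_mix p mu l).
Proof.
pose L x : 'I_n.+1 := inord (L_top x).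
have LE x : L x = L_top x :> nat by rewrite inordK // ltnS L_top_le.
rewrite big_mkord (partition_big L predT) //=; apply: eq_bigr => l _.
rewrite /Pr mulr_suml; apply: eq_big => [x|x /eqP <-].
  by rewrite inE -val_eqE /= LE.
by rewrite Qt_mix_density LE.
Qed.

Lemma sep_Qt_mix :
  sep (@Qt_mix R n p mu) (@U R n p) = 1 - S_mix p mu (p == 1%N).
Proof.
rewrite /sep; congr (1 - _); apply: min_val_eq => [x|].
  by rewrite Qt_mix_density S_mix_mono // L_top_ge // L_top_le.
by have [x Lx] := L_top_min hn hp; exists x; rewrite Qt_mix_density Lx.
Qed.

Lemma Linf_norm_Qt_mix :
  Linf_norm (fun x : colored_perm n p => Qt_mix mu x / U R x - 1) = S_mix p mu n - 1.
Proof.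
have le1n : ((p == 1%N) <= n)%N by case: eqP.
have S_two := S_mix_two.
have S_min : S_mix p mu (p == 1%N) <= S_mix p mu n by rewrite S_mix_mono // le1n /=.
apply/le_anti/andP; split.
  (* The maximum starts from 0, so [S_mix p mu n >= 1] is needed too; it follows from [S_two] and
     [S_min]. *)
  apply: bigmax_le => [|x _]; first lra.
  rewrite Qt_mix_density ler_norml.
  have S_le : S_mix p mu (L_top x) <= S_mix p mu n.
    by rewrite S_mix_mono // L_top_le leqnn.
  have S_ge : S_mix p mu (p == 1%N) <= S_mix p mu (L_top x).
    by rewrite S_mix_mono // L_top_ge // L_top_le.
  by apply/andP; split; lra.
apply: (bigmax_sup (1%g : colored_perm n p)) => //.
by rewrite Qt_mix_density L_top_one ler_norm.
Qed.

End Mixture.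

Theorem theorem1p1 (R : realType) (n p : nat) (hn : (1 <= n)%N) (hp : (1 <= p)%N)
    (mu : 'I_n.+1 -> R) (hmu : is_pmf mu) :
  [/\ (forall x : colored_perm n p,
         Qt_mix mu x / U R x = S_mix p mu (L_top x)),
      (forall Phi : R -> R,
         \sum_(x : colored_perm n p) U R x * Phi (Qt_mix mu x / U R x)
         = \sum_(0 <= l < n.+1)
             Pr (@U R n p) [set x | L_top x == l] * Phi (S_mix p mu l)),
      sep (@Qt_mix R n p mu) (@U R n p)
        = (if p == 1%N then 1 - mu (sub_ord 0) - mu (sub_ord 1)
           else 1 - mu (sub_ord 0)),
      Linf_norm (fun x : colored_perm n p => Qt_mix mu x / U R x - 1)
        = S_mix p mu n - 1
    & S_mix p mu n - 1
        = \sum_(0 <= u < n.+1) mu (sub_ord u) * u`!%:R * p%:R ^+ u - 1].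
Proof.
split=> //.
- exact: Qt_mix_density.
- exact: sum_U_density.
(* For [p = 1] the terms [u = 0] and [u = 1] remain, otherwise only [u = 0]; all have weight 1. *)
- rewrite sep_Qt_mix // /S_mix; case: eqP => [->|_] /=.
    by rewrite big_nat_recl // big_nat1 /= fact0 !expr1n !mulr1 opprD addrA.
  by rewrite big_nat1 fact0 expr0 !mulr1.
- exact: Linf_norm_Qt_mix.
Qed.
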